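(* Let $F,f\colon\mathbb R^n\times\mathbb R^m\to\mathbb R$, $G\colon\mathbb R^n\times\mathbb R^m\to\mathbb R^s$, and $g\colon\mathbb R^n\times\mathbb R^m\to\mathbb R^t$ be twice continuously differentiable and let $\lambda>0$ be given. Let $(w,\xi)=((x,y),(\mu,\nu,\hat\nu))\in\mathbb R^{n+m}\times\mathbb R^{s+2t}$ be a solution of the stationarity system $$\begin{aligned}&\nabla F(x,y)+G'(x,y)^\top\mu+g'(x,y)^\top(\nu-\lambda\hat\nu)=0,\qquad \nabla_yf(x,y)+g'_y(x,y)^\top\hat\nu=0,\\ &\mu\ge0,\ G(x,y)\le0,\ \mu^\top G(x,y)=0,\\ &\nu\ge0,\ g(x,y)\le0,\ \nu^\top g(x,y)=0,\\ &\hat\nu\ge0,\ g(x,y)\le 0,\ \hat\nu^\top g(x,y)=0.\end{aligned}$$ Let LLICQ and BLICQ be satisfied at $(x,y)$, let $I^{00}_g(x,y,\hat\nu)\subset I^+_g(x,y,\nu)$ hold, and assume that the second-order condition $$\forall\,\delta w\in\mathcal C(w,\xi)\setminus\{0\}\colon\quad \delta w^\top\nabla^2_{ww}L^{\mathrm{op}}_\lambda(w,\xi)\,\delta w>0$$ holds. Define $$\mathcal G(w,\xi):=\begin{bmatrix}G(x,y)\\ g(x,y)\\ g(x,y)\end{bmatrix},\qquad \mathcal H(w,\xi):=\begin{bmatrix}\nabla_wL^{\mathrm{op}}_\lambda(w,\xi)\\ \nabla_y\ell^{\mathrm{op}}(w,\xi)\end{bmatrix},\qquad p_2:=s+2t.$$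 Then $(w,\xi)$ is a solution of $\mathcal H(w,\xi)=0$, $\mathcal G(w,\xi)\le0$, $\xi\ge0$, $\mathcal G(w,\xi)^\top\xi=0$, and for each pair $(a,b)\in\mathbb R^{p_2}\times\mathbb R^{p_2}$ satisfying $$a_i=0,\ b_i=1\ \ (i\in I^-(w,\xi)),\qquad a_i=1,\ b_i=0\ \ (i\in I^+(w,\xi)),\qquad (a_i-1)^2+(b_i-1)^2=1\ \ (i\in I^{00}(w,\xi)),$$ the matrix $$\begin{bmatrix}\mathcal H'_w(w,\xi)&\mathcal H'_\xi(w,\xi)\\ \operatorname{diag}(a)\,\mathcal G'_w(w,\xi)&\operatorname{diag}(a)\,\mathcal G'_\xi(w,\xi)-\operatorname{diag}(b)\end{bmatrix}$$ possesses linearly independent columns.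
   Context: For $w=(x,y)\in\mathbb R^{n+m}$ and $\xi=(\mu,\nu,\hat\nu)\in\mathbb R^{s}\times\mathbb R^t\times\mathbb R^t$, $$L^{\mathrm{op}}_\lambda(w,\xi):=F(x,y)+\mu^\top G(x,y)+(\nu-\lambda\hat\nu)^\top g(x,y),\qquad \ell^{\mathrm{op}}(w,\xi):=f(x,y)+\hat\nu^\top g(x,y).$$ Let $I^0_G(x,y):=\{i\mid G_i(x,y)=0\}$, $I^+_G(x,y,\mu):=\{i\in I^0_G(x,y)\mid\mu_i>0\}$, $I^0_g(x,y):=\{i\mid g_i(x,y)=0\}$, and for $\eta\in\mathbb R^t$ (used with $\eta=\nu$ and $\eta=\hat\nu$) $I^+_g(x,y,\eta):=\{i\in I^0_g(x,y)\mid\eta_i>0\}$, $I^{00}_g(x,y,\eta):=\{i\in I^0_g(x,y)\mid\eta_i=0\}$. The critical subspace is $$\mathcal C(w,\xi):=\{\delta w\in\mathbb R^{n+m}\mid G_i'(x,y)\delta w=0\ (i\in I^+_G(x,y,\mu)),\ g_i'(x,y)\delta w=0\ (i\in I^+_g(x,y,\nu)\cup I^+_g(x,y,\hat\nu))\}.$$ LLICQ at $(x,y)$: the gradients $\nabla_yg_i(x,y)$, $i\in I^0_g(x,y)$, are linearly independent. BLICQ at $(x,y)$: the gradients $\nabla G_i(x,y)$ ($i\in I^0_G(x,y)$) together with $\nabla g_i(x,y)$ ($i\in I^0_g(x,y)$) (full gradients with respect to $(x,y)$) are linearly independent. For the mapping $\mathcal G$ with components $\mathcal G_i$, $i\in\{1,\dots,p_2\}$: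 $I^-(w,\xi):=\{i\mid\mathcal G_i(w,\xi)<0\}$, $I^+(w,\xi):=\{i\mid\mathcal G_i(w,\xi)=0,\ \xi_i>0\}$, $I^{00}(w,\xi):=\{i\mid\mathcal G_i(w,\xi)=0,\ \xi_i=0\}$. $\operatorname{diag}(v)$ is the diagonal matrix with diagonal $v$; subscripts $w,\xi$ on Jacobians denote partial Jacobians. *)

(* Defs.v *)
From mathcomp Require Import all_boot all_order all_algebra.
From mathcomp Require Import all_classical all_reals all_analysis.

Set Implicit Arguments.
Unset Strict Implicit.
Unset Printing Implicit Defensive.

Import Order.TTheory GRing.Theory Num.Theory.
Import numFieldNormedType.Exports.

Local Open Scope ring_scope.

(* All vectors are row vectors, as in the library's Jacobian 'J. Hence a column
   identity  z = A^T v  becomes  z = v *m A, and the number  v^T A v  is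
   (v *m A *m v^T) 0 0. A pair (x, y) in R^n x R^m is row_mx x y, and
   xi = (mu, nu, nuhat) is row_mx mu (row_mx nu nuhat). *)

Section Differentiation.
Variable R : realType.

Definition dot k (u v : 'rV[R]_k) : R := \sum_i u 0 i * v 0 i.

Definition partial k (W : normedModType R) (f : 'rV[R]_k -> W) (i : 'I_k)
    (p : 'rV[R]_k) : W :=
  'D_(delta_mx 0 i) f p.

Definition C1 k (W : normedModType R) (f : 'rV[R]_k -> W) : Prop :=
  (forall p, differentiable f p) /\ (forall i, continuous (partial f i)).

Definition C2 k (W : normedModType R) (f : 'rV[R]_k -> W) : Prop :=
  (forall p, differentiable f p) /\ (forall i, C1 (partial f i)).

Definition grad k (f : 'rV[R]_k -> R) (p : 'rV[R]_k) : 'rV[R]_k :=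
  \row_i partial f i p.

(* The library's 'J f p satisfies  'd f p v = v *m 'J f p, so it is the
   transpose of f'(p), whose (i, j) entry is the j-th partial of f_i. *)
Definition jac k l (f : 'rV[R]_k -> 'rV[R]_l) (p : 'rV[R]_k) : 'M[R]_(l, k) :=
  ('J f p)^T.

Definition hess k (f : 'rV[R]_k -> R) (p : 'rV[R]_k) : 'M[R]_k :=
  jac (grad f) p.

Definition component k l (f : 'rV[R]_k -> 'rV[R]_l) (i : 'I_l)
    (p : 'rV[R]_k) : R :=
  f p 0 i.

Definition grad_y n m (f : 'rV[R]_(n + m) -> R) (w : 'rV[R]_(n + m)) :
    'rV[R]_m :=
  grad (fun y => f (row_mx (lsubmx w) y)) (rsubmx w).

Definition jac_y n m l (f : 'rV[R]_(n + m) -> 'rV[R]_l) (w : 'rV[R]_(n + m)) :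
    'M[R]_(l, m) :=
  jac (fun y => f (row_mx (lsubmx w) y)) (rsubmx w).

End Differentiation.

(* Index sets, as functions of the constraint value c and the multiplier eta. *)
Section IndexSets.
Variables (R : realType) (k : nat).
Implicit Types c eta : 'rV[R]_k.

Definition Ineg c : {set 'I_k} := [set i | c 0 i < 0]%SET.
Definition I0 c : {set 'I_k} := [set i | c 0 i == 0]%SET.
Definition Ipos c eta : {set 'I_k} := [set i in I0 c | 0 < eta 0 i]%SET.
Definition I00 c eta : {set 'I_k} := [set i in I0 c | eta 0 i == 0]%SET.

Definition complementary c eta : Prop :=
  [/\ forall i, 0 <= eta 0 i, forall i, c 0 i <= 0 & dot eta c = 0].

End IndexSets.

Section Bilevel.
Variables (R : realType) (n m s t : nat).
Variables (F f : 'rV[R]_(n + m) -> R).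
Variables (G : 'rV[R]_(n + m) -> 'rV[R]_s) (g : 'rV[R]_(n + m) -> 'rV[R]_t).
Variable lambda : R.
Implicit Types (w dw : 'rV[R]_(n + m)) (xi : 'rV[R]_(s + (t + t))).

Definition xi_mu xi : 'rV[R]_s := lsubmx xi.
Definition xi_nu xi : 'rV[R]_t := lsubmx (rsubmx xi).
Definition xi_nuhat xi : 'rV[R]_t := rsubmx (rsubmx xi).

Definition Lop w xi : R :=
  F w + dot (xi_mu xi) (G w) + dot (xi_nu xi - lambda *: xi_nuhat xi) (g w).

Definition lop w xi : R := f w + dot (xi_nuhat xi) (g w).

Definition stationary w xi : Prop :=
  grad F w + xi_mu xi *m jac G w
    + (xi_nu xi - lambda *: xi_nuhat xi) *m jac g w = 0 /\
  grad_y f w + xi_nuhat xi *m jac_y g w = 0 /\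
  complementary (G w) (xi_mu xi) /\
  complementary (g w) (xi_nu xi) /\
  complementary (g w) (xi_nuhat xi).

Definition LLICQ w : Prop :=
  free [seq grad_y (component g i) w | i in I0 (g w)].

Definition BLICQ w : Prop :=
  free ([seq grad (component G i) w | i in I0 (G w)] ++
        [seq grad (component g i) w | i in I0 (g w)]).

Definition critical w xi dw : Prop :=
  (forall i, i \in Ipos (G w) (xi_mu xi) -> row i (jac G w) *m dw^T = 0) /\
  (forall i, i \in (Ipos (g w) (xi_nu xi) :|: Ipos (g w) (xi_nuhat xi))%SET ->
     row i (jac g w) *m dw^T = 0).

Definition SOC w xi : Prop :=
  forall dw, critical w xi dw -> dw <> 0 ->
    0 < (dw *m hess (fun v => Lop v xi) w *m dw^T) 0 0.

Definition calG w xi : 'rV[R]_(s + (t + t)) := row_mx (G w) (row_mx (g w) (g w)).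

Definition calH w xi : 'rV[R]_(n + m + m) :=
  row_mx (grad (fun v => Lop v xi) w) (grad_y (fun v => lop v xi) w).

Definition admissible w xi (a b : 'rV[R]_(s + (t + t))) : Prop :=
  [/\ forall i, i \in Ineg (calG w xi) -> a 0 i = 0 /\ b 0 i = 1,
      forall i, i \in Ipos (calG w xi) xi -> a 0 i = 1 /\ b 0 i = 0 &
      forall i, i \in I00 (calG w xi) xi ->
        (a 0 i - 1) ^+ 2 + (b 0 i - 1) ^+ 2 = 1].

Definition newton_mx w xi (a b : 'rV[R]_(s + (t + t))) :
    'M[R]_((n + m + m) + (s + (t + t)), (n + m) + (s + (t + t))) :=
  block_mx
    (jac (fun v => calH v xi) w) (jac (fun z => calH w z) xi)
    (diag_mx a *m jac (fun v => calG v xi) w)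
    (diag_mx a *m jac (fun z => calG w z) xi - diag_mx b).

End Bilevel.

(* Main.v *)
(* An element (dw, dmu, dnu, dnuhat) of the kernel of the matrix satisfies
     d(grad L)(dw) + G'^T dmu + g'^T (dnu - lambda dnuhat) = 0,
     d(grad_y l)(dw) + g_y'^T dnuhat = 0,
   and, row by row, a_i G_i' dw = b_i dmu_i and the analogues for g. The last
   relations give dxi_i = 0 at inactive constraints, (G, g, g)_i' dw = 0 where
   the multiplier is positive, and a nonnegative product of both at biactive
   ones (the circle keeps a_i, b_i >= 0 and a_i + b_i > 0). The inclusion
   I00_g(nuhat) in I+_g(nu) makes one of nu_i, nuhat_i positive for every active
   g_i, so g_i' dw = 0 there; hence dw is critical and the g-terms vanish when
   the first equation is multiplied by dw. What remains is dw^T Hess(L) dw <= 0,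
   so dw = 0 by the second-order condition. LLICQ applied to the second equation
   then yields dnuhat = 0, and BLICQ applied to the first dmu = dnu = 0. *)

Require Import Defs.
From HB Require Import structures.
From mathcomp Require Import all_boot all_order all_algebra.
From mathcomp Require Import all_classical all_reals all_analysis.
From mathcomp Require Import ring lra.
Set Implicit Arguments.
Unset Strict Implicit.
Unset Printing Implicit Defensive.

Import Order.TTheory GRing.Theory Num.Theory.
Import numFieldNormedType.Exports.
Local Open Scope ring_scope.

(** * Differentials, Jacobians and gradients in terms of the library's [is_diff] *)

Section Calculus.
Variable R : realType.

(** Continuity is automatic in finite dimension: [f] is a finite sum of coordinates times fixed
    vectors. Packing the proposition [linear f] into a linear structure then makes the general rule
    for differentials of linear maps apply. *)
Lemma linear_is_diff k (W : normedModType R) (f : 'rV[R]_k -> W)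
    (p : 'rV[R]_k) :
  linear f -> is_diff p f f.
Proof.
move=> flin.
pose fM := GRing.isLinear.Build _ _ _ _ _ flin.
pose fL : {linear 'rV[R]_k -> W} := HB.pack f fM.
have fE : f = fun v => \sum_i v 0 i *: f (delta_mx 0 i).
  apply/funext => v; rewrite -[f]/(fL : _ -> _) [in LHS](row_sum_delta v).
  by rewrite linear_sum; apply: eq_bigr => i _; rewrite linearZ.
have fc : continuous fL.
  rewrite -[fL : _ -> _]/f fE.
  apply: continuous_big => [|i _ v]; first exact: add_continuous.
  apply: continuousZr_tmp.
  exact: coord_continuous.
apply: DiffDef; first exact: (linear_differentiable (f := fL)).
by rewrite (@diff_lin _ _ _ fL).
Qed.

Lemma dot_linear k (u : 'rV[R]_k) : linear (dot u : 'rV[R]_k -> R).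
Proof.
move=> c v v'; rewrite /dot scaler_sumr -big_split; apply: eq_bigr => i _.
by rewrite !mxE mulrDr mulrCA.
Qed.

Lemma is_diff_linear_comp l (V W : normedModType R) (f df : V -> 'rV[R]_l)
    (h : 'rV[R]_l -> W) (p : V) :
  linear h -> is_diff p f df -> is_diff p (h \o f) (h \o df).
Proof. by move=> hlin fd; apply: is_diff_comp; exact: linear_is_diff. Qed.

(** Concatenation is a sum of two linear embeddings, each composed with one block, so the sum and
    chain rules suffice. *)
Lemma is_diff_row_mx (V : normedModType R) k l (f df : V -> 'rV[R]_k)
    (h dh : V -> 'rV[R]_l) (p : V) :
  is_diff p f df -> is_diff p h dh ->
  is_diff p (fun v => row_mx (f v) (h v)) (fun v => row_mx (df v) (dh v)).
Proof.
move=> fd hd.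
pose L (u : 'rV[R]_k) : 'rV[R]_(k + l) := row_mx u 0.
pose L' (u : 'rV[R]_l) : 'rV[R]_(k + l) := row_mx 0 u.
have Llin : linear L.
  by move=> c u v; rewrite /L scale_row_mx add_row_mx scaler0 addr0.
have Llin' : linear L'.
  by move=> c u v; rewrite /L' scale_row_mx add_row_mx scaler0 addr0.
have rowE (f1 : V -> 'rV[R]_k) h1 :
    (fun v => row_mx (f1 v) (h1 v)) = (L \o f1) + (L' \o h1).
  apply/funext => v; rewrite -[RHS]/(L (f1 v) + L' (h1 v)) /L /L'.
  by rewrite add_row_mx addr0 add0r.
by rewrite !rowE; apply: is_diffD; apply: is_diff_linear_comp.
Qed.

Lemma mul_jac_tr k l (f df : 'rV[R]_k -> 'rV[R]_l) (p v : 'rV[R]_k) :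
  is_diff p f df -> jac f p *m v^T = (df v)^T.
Proof.
by move=> fd; rewrite /jac -trmx_mul /jacobian mul_rV_lin1 /= diff_val.
Qed.

Lemma partialE k (W : normedModType R) (f df : 'rV[R]_k -> W) i p :
  is_diff p f df -> partial f i p = df (delta_mx 0 i).
Proof. by move=> fd; rewrite /partial deriveE // diff_val. Qed.

Lemma jacE k l (f : 'rV[R]_k -> 'rV[R]_l) p i j :
  jac f p i j = 'd f p (delta_mx 0 j) 0 i.
Proof. by rewrite !mxE. Qed.

Lemma gradD k (f h : 'rV[R]_k -> R) p : differentiable f p ->
  differentiable h p -> grad (fun v => f v + h v) p = grad f p + grad h p.
Proof.
move=> fd hd; apply/rowP => i; rewrite !mxE.
rewrite (partialE _ (is_diffD (differentiableP fd) (differentiableP hd))).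
by rewrite !(partialE _ (differentiableP _)).
Qed.

Lemma grad_dot k l (u : 'rV[R]_l) (f : 'rV[R]_k -> 'rV[R]_l) p :
  differentiable f p -> grad (fun v => dot u (f v)) p = u *m jac f p.
Proof.
move=> fd; apply/rowP => i; rewrite !mxE.
rewrite (partialE _ (is_diff_linear_comp (dot_linear u) (differentiableP fd))).
by apply: eq_bigr => j _; rewrite jacE.
Qed.

Lemma componentE k l (f : 'rV[R]_k -> 'rV[R]_l) (i : 'I_l) :
  component f i = dot (delta_mx 0 i) \o f.
Proof.
apply/funext => v; rewrite /= /dot (bigD1 i) //= big1 => [|j /negPf ji].
  by rewrite !mxE !eqxx mul1r addr0.
by rewrite !mxE ji andbF mul0r.
Qed.

Lemma grad_component k l (f : 'rV[R]_k -> 'rV[R]_l) (i : 'I_l) p :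
  differentiable f p -> grad (component f i) p = row i (jac f p).
Proof. by move=> fd; rewrite componentE grad_dot // -rowE. Qed.

(** Chain rule through the affine map [y] to [row_mx x y], whose differential is [row_mx 0]. It
    identifies derivatives in [y] with blocks of full derivatives. *)
Lemma is_diff_rowr n m (W : normedModType R) (f : 'rV[R]_(n + m) -> W)
    (w : 'rV[R]_(n + m)) : differentiable f w ->
  is_diff (rsubmx w) (fun y => f (row_mx (lsubmx w) y))
    (fun y => 'd f w (row_mx 0 y)).
Proof.
move=> fd; apply: (@is_diff_comp _ _ _ _ (row_mx (lsubmx w)) (row_mx 0) f).
  apply: (@is_diff_row_mx _ _ _ (fun=> lsubmx w) (fun=> 0) id id).
by rewrite hsubmxK; apply: differentiableP.
Qed.

Lemma row_mx0_delta n m (j : 'I_m) :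
  row_mx 0 (delta_mx 0 j) = delta_mx 0 (rshift n j) :> 'rV[R]_(n + m).
Proof.
apply/rowP => i; rewrite !mxE; case: fintype.splitP => l il; rewrite !mxE /=.
  by rewrite -val_eqE /= il [_ == _](ltn_eqF _) // ltn_addr.
by rewrite -!val_eqE /= il eqn_add2l.
Qed.

Lemma grad_yE n m (f : 'rV[R]_(n + m) -> R) w :
  differentiable f w -> grad_y f w = rsubmx (grad f w).
Proof.
move=> fd; apply/rowP => i; rewrite !mxE (partialE _ (is_diff_rowr fd)).
by rewrite (partialE _ (differentiableP fd)) row_mx0_delta.
Qed.

Lemma jac_yE n m l (f : 'rV[R]_(n + m) -> 'rV[R]_l) w :
  differentiable f w -> jac_y f w = rsubmx (jac f w).
Proof.
move=> fd; apply/matrixP => i j; rewrite /jac_y jacE.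
have := is_diff_rowr fd; case=> _ ->.
by rewrite mxE jacE row_mx0_delta.
Qed.

(** * Stability of [C1] and [C2] under sums and linear post-composition *)

Lemma partialD k (W : normedModType R) (f h : 'rV[R]_k -> W) i :
  (forall p, differentiable f p) -> (forall p, differentiable h p) ->
  partial (f + h) i = partial f i + partial h i.
Proof.
move=> fd hd; apply/funext => p.
have fp := differentiableP (fd p); have hp := differentiableP (hd p).
rewrite (partialE _ (is_diffD fp hp)) -[RHS]/(partial f i p + partial h i p).
by rewrite (partialE _ fp) (partialE _ hp).
Qed.

Lemma C1D k (W : normedModType R) (f h : 'rV[R]_k -> W) :
  C1 f -> C1 h -> C1 (f + h).
Proof.
move=> [fd fc] [hd hc]; split=> [p|i]; first exact: differentiableD.
by rewrite partialD // => p; apply: continuousD; [exact: fc | exact: hc].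
Qed.

Lemma C2D k (W : normedModType R) (f h : 'rV[R]_k -> W) :
  C2 f -> C2 h -> C2 (f + h).
Proof.
move=> [fd f1] [hd h1]; split=> [p|i]; first exact: differentiableD.
by rewrite partialD //; apply: C1D.
Qed.

Lemma partial_linear_comp k l (W : normedModType R) (h : 'rV[R]_l -> W)
    (f : 'rV[R]_k -> 'rV[R]_l) i : linear h ->
  (forall p, differentiable f p) -> partial (h \o f) i = h \o partial f i.
Proof.
move=> hlin fd; apply/funext => p.
rewrite (partialE _ (is_diff_linear_comp hlin (differentiableP (fd p)))) /=.
by rewrite (partialE _ (differentiableP (fd p))).
Qed.

Lemma C1_linear_comp k l (W : normedModType R) (h : 'rV[R]_l -> W)
    (f : 'rV[R]_k -> 'rV[R]_l) : linear h -> C1 f -> C1 (h \o f).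
Proof.
move=> hlin [fd fc]; have hd v := linear_is_diff v hlin.
split=> [p|i]; first exact: differentiable_comp.
rewrite partial_linear_comp // => p; apply: continuous_comp; first exact: fc.
exact: differentiable_continuous.
Qed.

Lemma C2_linear_comp k l (W : normedModType R) (h : 'rV[R]_l -> W)
    (f : 'rV[R]_k -> 'rV[R]_l) : linear h -> C2 f -> C2 (h \o f).
Proof.
move=> hlin [fd f1]; split=> [p|i]; last first.
  by rewrite partial_linear_comp //; apply: C1_linear_comp.
have hd v := linear_is_diff v hlin; exact: differentiable_comp.
Qed.

(** The gradient is a finite sum of differentiable partials times fixed basis vectors. *)
Lemma differentiable_grad k (f : 'rV[R]_k -> R) p :
  C2 f -> differentiable (grad f) p.
Proof.
move=> [_ f1].
have -> : grad f = \sum_i (fun v => partial f i v *: (delta_mx 0 i : 'rV[R]_k)).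
  apply/funext => v; rewrite fct_sumE [LHS]row_sum_delta.
  by apply: eq_bigr => i _; rewrite mxE.
apply: differentiable_sum => i; apply: differentiableZl.
by case: (f1 i).
Qed.

End Calculus.

(** * Freeness of families, and a sign argument on the circle *)

Section LinearAlgebra.
Variable R : realType.

(** Coefficients are indexed by the elements of [r] instead of by positions. Without repetitions in
    [r] the two kinds of coefficient families correspond. *)
Lemma free_mapP (vT : vectType R) (I : eqType) (v : I -> vT) (r : seq I) :
  uniq r ->
  free (map v r) <->
  (forall c : I -> R,
     \sum_(i <- r) c i *: v i = 0 -> {in r, forall i, c i = 0}).
Proof.
move=> r_uniq; pose X := map_tuple v (in_tuple r).
have XE (i : 'I_(size r)) : X`_i = v (tnth (in_tuple r) i).
  by rewrite -tnth_map [RHS](tnth_nth 0).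
have sumE c : \sum_(i <- r) c i *: v i =
    \sum_(i < size r) c (tnth (in_tuple r) i) *: X`_i.
  by rewrite big_tnth; apply: eq_bigr => i _; rewrite XE.
split=> [/(@freeP _ _ _ X) Xfree c | Xfree];
  last apply/(@freeP _ _ _ X) => k k0 i.
  rewrite sumE => /Xfree c0 i /seq_tnthP [j ->]; exact: c0.
have idxP j : index (tnth (in_tuple r) j) r = j.
  by rewrite (tnth_nth (tnth (in_tuple r) j)) index_uniq.
(* Turns positional coefficients into a function on [I]: the sum has at most one term, and is empty
   for [x] outside [r]. *)
pose c x := \sum_(j < size r | index x r == j) k j.
have cE j : c (tnth (in_tuple r) j) = k j.
  by rewrite /c (big_pred1 j) // => j' /=; rewrite idxP -val_eqE eq_sym.
rewrite -cE; apply: Xfree; last by rewrite mem_tnth.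
by rewrite sumE -[RHS]k0; apply: eq_bigr => j _; rewrite cE.
Qed.

Lemma free_cols p q (A : 'M[R]_(p, q)) :
  (forall z : 'rV[R]_q, A *m z^T = 0 -> z = 0) ->
  free [seq col j A | j : 'I_q].
Proof.
move=> A0; apply/free_mapP => [|c c0 j _]; first exact: enum_uniq.
have /A0 /rowP /(_ j) : A *m (\row_j c j)^T = 0; last by rewrite !mxE.
rewrite -[RHS]c0 big_enum /=; apply/colP => i; rewrite mxE summxE.
by apply: eq_bigr => l _; rewrite !mxE mulrC.
Qed.

Lemma mulmx_sum_support k l (D : {set 'I_k}) (u : 'rV[R]_k) (A : 'M[R]_(k, l)) :
  (forall i, i \notin D -> u 0 i = 0) ->
  u *m A = \sum_(i in D) u 0 i *: row i A.
Proof.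
move=> uD; rewrite mulmx_sum_row (bigID (mem D)) /= [X in _ + X]big1 ?addr0 //.
by move=> i /uD ->; rewrite scale0r.
Qed.

Lemma free_rows_eq0 k l (D : {set 'I_k}) (u : 'rV[R]_k) (A : 'M[R]_(k, l)) :
  free [seq row i A | i in D] -> (forall i, i \notin D -> u 0 i = 0) ->
  u *m A = 0 -> u = 0.
Proof.
move=> /(free_mapP _ (enum_uniq _)) Afree uD.
rewrite (mulmx_sum_support _ uD) -big_enum => /Afree u0.
apply/rowP => i; rewrite mxE; case: (boolP (i \in D)) => [iD|/uD //].
by apply: u0; rewrite mem_enum.
Qed.

(** Freeness of the concatenation makes the two spans independent. As [u *m A] is the opposite of
    [u' *m A'], it lies in both spans and vanishes; each free family is then treated alone. *)
Lemma free_rows_eq0_2 k k' l (D : {set 'I_k}) (D' : {set 'I_k'})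
    (u : 'rV[R]_k) (u' : 'rV[R]_k') (A : 'M[R]_(k, l)) (A' : 'M[R]_(k', l)) :
  free ([seq row i A | i in D] ++ [seq row i A' | i in D']) ->
  (forall i, i \notin D -> u 0 i = 0) ->
  (forall i, i \notin D' -> u' 0 i = 0) ->
  u *m A + u' *m A' = 0 -> u = 0 /\ u' = 0.
Proof.
rewrite cat_free => /and3P [Afree A'free /directv_addP disj] uD uD' uA0.
have memA p (E : {set 'I_p}) (v : 'rV[R]_p) (B : 'M[R]_(p, l)) :
    (forall i, i \notin E -> v 0 i = 0) ->
    v *m B \in <<[seq row i B | i in E]>>%VS.
  move=> vE; rewrite (mulmx_sum_support _ vE); apply: rpred_sum => i iE.
  by apply/rpredZ/memv_span/map_f; rewrite mem_enum.
have uA : u *m A = 0.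
  apply/eqP; rewrite -memv0 -disj memv_cap memA //=.
  by rewrite -(addr0_eq (etrans (addrC _ _) uA0)) // rpredN memA.
split; first exact: free_rows_eq0 Afree uD uA.
by apply: (free_rows_eq0 A'free uD'); rewrite uA add0r in uA0.
Qed.

(** The circle of radius 1 around (1, 1) lies in the closed positive quadrant and avoids the origin.
    Multiplying [u * d] by [a + b > 0] gives a combination of squares with nonnegative weights. *)
Lemma circle_mul_ge0 (a b u d : R) :
  (a - 1) ^+ 2 + (b - 1) ^+ 2 = 1 -> a * u = b * d -> 0 <= u * d.
Proof.
move=> circ aubd.
have := (sqr_ge0 a, sqr_ge0 b, sqr_ge0 (a - 1), sqr_ge0 (b - 1)).
move=> [[[a2 b2] a12] b12].
(* Expanding the circle equation gives 2a = a^2 + (b-1)^2, symmetrically for b, and 2(a+b) = 1 + a^2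
   + b^2. *)
have a0 : 0 <= a by lra.
have b0 : 0 <= b by lra.
have ab : 0 < a + b by lra.
have abud : (a + b) * (u * d) = b * d ^+ 2 + a * u ^+ 2.
  have -> : (a + b) * (u * d) = (a * u) * d + (b * d) * u by ring.
  by rewrite aubd -[in X in _ + X]aubd; ring.
by rewrite -(pmulr_rge0 _ ab) abud; rewrite addr_ge0 // mulr_ge0 // sqr_ge0.
Qed.

Lemma dot_row_mx k l (u v : 'rV[R]_k) (u' v' : 'rV[R]_l) :
  dot (row_mx u u') (row_mx v v') = dot u v + dot u' v'.
Proof.
by rewrite /dot big_split_ord /=; congr (_ + _); apply: eq_bigr => i _;
  rewrite ?row_mxEl ?row_mxEr.
Qed.

Lemma complementary_row_mx k l (c eta : 'rV[R]_k) (c' eta' : 'rV[R]_l) :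
  complementary c eta -> complementary c' eta' ->
  complementary (row_mx c c') (row_mx eta eta').
Proof.
move=> [eta0 c0 d0] [eta0' c0' d0']; split.
- by move=> i; rewrite mxE; case: fintype.splitP.
- by move=> i; rewrite mxE; case: fintype.splitP.
- by rewrite dot_row_mx d0 d0' addr0.
Qed.

End LinearAlgebra.

(** * Derivatives of [calH] and [calG], and the kernel equations of the matrix *)

Section NewtonSystem.
Variables (R : realType) (n m s t : nat).
Variables (F f : 'rV[R]_(n + m) -> R).
Variables (G : 'rV[R]_(n + m) -> 'rV[R]_s) (g : 'rV[R]_(n + m) -> 'rV[R]_t).
Variable lambda : R.
Hypotheses (F2 : C2 F) (f2 : C2 f) (G2 : C2 G) (g2 : C2 g).
Implicit Types (w dw : 'rV[R]_(n + m)) (xi dxi : 'rV[R]_(s + (t + t))).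

Let dF w : differentiable F w. Proof. by case: F2. Qed.
Let df w : differentiable f w. Proof. by case: f2. Qed.
Let dG w : differentiable G w. Proof. by case: G2. Qed.
Let dg w : differentiable g w. Proof. by case: g2. Qed.

Lemma C2_Lop xi : C2 (fun w => Lop F G g lambda w xi).
Proof.
apply: C2D; last exact: C2_linear_comp (dot_linear _) g2.
apply: C2D F2 _; exact: C2_linear_comp (dot_linear _) G2.
Qed.

Lemma C2_lop xi : C2 (fun w => lop f g w xi).
Proof. apply: C2D f2 _; exact: C2_linear_comp (dot_linear _) g2. Qed.

Let differentiable_dot k (h : 'rV[R]_(n + m) -> 'rV[R]_k) u w :
  differentiable h w -> differentiable (fun v => dot u (h v)) w.
Proof.
by move=> /differentiableP dh; have [] := is_diff_linear_comp (dot_linear u) dh.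
Qed.

Lemma grad_Lop w xi : grad (fun v => Lop F G g lambda v xi) w =
  grad F w + xi_mu xi *m jac G w
    + (xi_nu xi - lambda *: xi_nuhat xi) *m jac g w.
Proof.
have dGmu := differentiable_dot (xi_mu xi) (dG w).
have dgnu := differentiable_dot (xi_nu xi - lambda *: xi_nuhat xi) (dg w).
by rewrite (gradD (differentiableD (dF w) dGmu) dgnu) (gradD _ dGmu) ?grad_dot.
Qed.

Lemma grad_lop w xi :
  grad (fun v => lop f g v xi) w = grad f w + xi_nuhat xi *m jac g w.
Proof. by rewrite (gradD _ (differentiable_dot _ (dg w))) ?grad_dot. Qed.

(** Makes the second block a linear image of a full gradient, so that it can be differentiated
    through [differentiable_grad]. *)
Lemma calHE w xi : calH F f G g lambda w xi =
  row_mx (grad (fun v => Lop F G g lambda v xi) w)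
         (rsubmx (grad (fun v => lop f g v xi) w)).
Proof. by rewrite /calH grad_yE //; case: (C2_lop xi). Qed.

Lemma rsubmx_linear k1 k2 : linear (rsubmx : 'rV[R]_(k1 + k2) -> 'rV[R]_k2).
Proof. by move=> c u v; rewrite linearP. Qed.

Lemma is_diff_calH_w w xi : is_diff w (fun v => calH F f G g lambda v xi)
  (fun dw => row_mx ('d (grad (fun v => Lop F G g lambda v xi)) w dw)
                    (rsubmx ('d (grad (fun v => lop f g v xi)) w dw))).
Proof.
rewrite (funext (fun v => calHE v xi)); apply: is_diff_row_mx.
  exact/differentiableP/differentiable_grad/C2_Lop.
apply: is_diff_linear_comp; first exact: rsubmx_linear.
exact/differentiableP/differentiable_grad/C2_lop.
Qed.

Lemma is_diff_calH_xi w xi : is_diff xi (fun z => calH F f G g lambda w z)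
  (fun dxi => row_mx (xi_mu dxi *m jac G w +
                      (xi_nu dxi - lambda *: xi_nuhat dxi) *m jac g w)
                     (rsubmx (xi_nuhat dxi *m jac g w))).
Proof.
rewrite (funext (fun z => calHE w z)).
rewrite (funext (fun z => congr2 row_mx (grad_Lop w z)
                                 (congr1 rsubmx (grad_lop w z)))).
apply: is_diff_row_mx.
  pose L (z : 'rV[R]_(s + (t + t))) := xi_mu z *m jac G w +
    (xi_nu z - lambda *: xi_nuhat z) *m jac g w.
  have Llin : linear L.
    move=> c u v; rewrite /L /xi_mu /xi_nu /xi_nuhat !linearP /=.
    by rewrite addrACA -scalerDr mulmxDl [X in _ + X]mulmxDl -!scalemxAl
      scalerDr addrACA.
  (* Reassociation exhibits the block as a constant plus the linear map [L], whose differential is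
     [L] itself. *)
  rewrite (funext (fun z => esym (addrA (grad F w) (xi_mu z *m jac G w)
    ((xi_nu z - lambda *: xi_nuhat z) *m jac g w)))).
  have := is_diffD (is_diff_cst (grad F w) xi) (linear_is_diff xi Llin).
  by rewrite add0r.
apply: is_diff_linear_comp; first exact: rsubmx_linear.
pose L (z : 'rV[R]_(s + (t + t))) := xi_nuhat z *m jac g w.
have Llin : linear L.
  by move=> c u v; rewrite /L /xi_nuhat !linearP /= mulmxDl scalemxAl.
have := is_diffD (is_diff_cst (grad f w) xi) (linear_is_diff xi Llin).
by rewrite add0r.
Qed.

Lemma is_diff_calG_w w xi : is_diff w (fun v => calG G g v xi)
  (fun dw => row_mx ('d G w dw) (row_mx ('d g w dw) ('d g w dw))).
Proof. by do 2?[apply: is_diff_row_mx]; apply: differentiableP. Qed.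

Lemma newton_mx_kernel w xi a b dw dxi :
  newton_mx F f G g lambda w xi a b *m (row_mx dw dxi)^T = 0 ->
  [/\ 'd (grad (fun v => Lop F G g lambda v xi)) w dw + xi_mu dxi *m jac G w
        + (xi_nu dxi - lambda *: xi_nuhat dxi) *m jac g w = 0,
      rsubmx ('d (grad (fun v => lop f g v xi)) w dw
              + xi_nuhat dxi *m jac g w) = 0 &
      forall i,
        a 0 i * (row_mx ('d G w dw) (row_mx ('d g w dw) ('d g w dw))) 0 i
        = b 0 i * dxi 0 i].
Proof.
rewrite tr_row_mx mul_block_col mulmxBl -!mulmxA.
rewrite (mul_jac_tr _ (is_diff_calH_w w xi)).
rewrite (mul_jac_tr _ (is_diff_calH_xi w xi)).
rewrite (mul_jac_tr _ (is_diff_calG_w w xi)).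
(* [calG] is constant in [xi], so the lower right block reduces to [- diag_mx b]. *)
rewrite (mul_jac_tr _ (is_diff_cst (calG G g w xi) xi)) trmx0 mulmx0 sub0r.
move=> /eqP; rewrite col_mx_eq0 => /andP [/eqP HH /eqP HG].
have := congr1 trmx HH; rewrite linearD /= !trmxK trmx0 add_row_mx.
move=> /eqP; rewrite row_mx_eq0 => /andP [/eqP H1 /eqP H2].
split; [by rewrite -addrA | by rewrite linearD | move=> i].
move/colP: HG => /(_ i); rewrite !mul_diag_mx !mxE.
by move=> /eqP; rewrite subr_eq0 => /eqP.
Qed.

Lemma BLICQ_rows w : BLICQ G g w ->
  free ([seq row i (jac G w) | i in I0 (G w)] ++
        [seq row i (jac g w) | i in I0 (g w)]).
Proof.
rewrite /BLICQ (funext (fun i => grad_component i (dG w))).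
by rewrite (funext (fun i => grad_component i (dg w))).
Qed.

(** Recasts LLICQ in the form used by [free_rows_eq0]: the [y]-gradients of the components of [g]
    are the [y]-blocks of the Jacobian rows. *)
Lemma LLICQ_rows w : LLICQ g w ->
  free [seq row i (rsubmx (jac g w)) | i in I0 (g w)].
Proof.
have yE i : grad_y (component g i) w = row i (rsubmx (jac g w)).
  rewrite grad_yE; last by rewrite componentE; apply: differentiable_dot.
  by rewrite grad_component //; apply/rowP => j; rewrite !mxE.
by rewrite /LLICQ (funext yE).
Qed.

End NewtonSystem.

(** * Sign information on kernel elements, and the proof of the theorem *)

Section Kernel.
Variables (R : realType) (n m s t : nat).
Variables (G : 'rV[R]_(n + m) -> 'rV[R]_s) (g : 'rV[R]_(n + m) -> 'rV[R]_t).
Implicit Types (w dw : 'rV[R]_(n + m)) (a b xi dxi : 'rV[R]_(s + (t + t))).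

(** [D] stands for the derivative of [calG] along [dw]. At an inactive index (a, b) = (0, 1)
    annihilates [dxi]; at a positive multiplier (1, 0) annihilates [D]; at a biactive index
    [circle_mul_ge0] gives the sign. *)
Lemma admissible_kernel w xi a b (D : 'rV[R]_(s + (t + t))) dxi i :
  complementary (calG G g w xi) xi -> admissible G g w xi a b ->
  a 0 i * D 0 i = b 0 i * dxi 0 i ->
  [/\ calG G g w xi 0 i != 0 -> dxi 0 i = 0,
      calG G g w xi 0 i = 0 -> 0 < xi 0 i -> D 0 i = 0 &
      0 <= D 0 i * dxi 0 i].
Proof.
move=> [xi0 c0 _] [neg pos zer] abi.
have dxi0 : calG G g w xi 0 i != 0 -> dxi 0 i = 0.
  move=> ci; have /neg [ai bi] : i \in Ineg (calG G g w xi).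
    by rewrite inE lt_neqAle ci c0.
  by move: abi; rewrite ai bi mul0r mul1r.
have D0 : calG G g w xi 0 i = 0 -> 0 < xi 0 i -> D 0 i = 0.
  move=> ci xii; have /pos [ai bi] : i \in Ipos (calG G g w xi) xi.
    by rewrite !inE ci eqxx.
  by move: abi; rewrite ai bi mul0r mul1r.
split=> //; have [ci|/dxi0 ->] := eqVneq (calG G g w xi 0 i) 0; last first.
  by rewrite mulr0.
have [xii|xii] := eqVneq (xi 0 i) 0; last by rewrite D0 ?mul0r // lt0r xii xi0.
apply: circle_mul_ge0 abi; apply: zer.
by rewrite !inE ci xii !eqxx.
Qed.

Lemma row_jac_mul_tr k l (h : 'rV[R]_k -> 'rV[R]_l) p v i :
  differentiable h p -> 'd h p v 0 i = 0 -> row i (jac h p) *m v^T = 0.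
Proof.
move=> /differentiableP hd hi0; rewrite -row_mul (mul_jac_tr _ hd).
by apply/rowP => j; rewrite !mxE ord1.
Qed.

(** Moving the Jacobian to the other factor of the pairing turns the multiplier terms into sums of
    the products whose signs are known. *)
Lemma mul_tr_jac k l (h : 'rV[R]_k -> 'rV[R]_l) p v (u : 'rV[R]_l) :
  differentiable h p ->
  (v *m (u *m jac h p)^T) 0 0 = \sum_i 'd h p v 0 i * u 0 i.
Proof.
move=> /differentiableP hd; rewrite trmx_mul mulmxA -[v in LHS]trmxK -trmx_mul.
by rewrite (mul_jac_tr _ hd) trmxK mxE; apply: eq_bigr => i _; rewrite mxE.
Qed.

End Kernel.

Theorem theorem5p4 (R : realType) (n m s t : nat)
    (F f : 'rV[R]_(n + m) -> R)
    (G : 'rV[R]_(n + m) -> 'rV[R]_s) (g : 'rV[R]_(n + m) -> 'rV[R]_t)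
    (lambda : R) (x : 'rV[R]_n) (y : 'rV[R]_m)
    (mu : 'rV[R]_s) (nu nuhat : 'rV[R]_t) :
  let w := row_mx x y in
  let xi := row_mx mu (row_mx nu nuhat) in
  C2 F -> C2 f -> C2 G -> C2 g ->
  0 < lambda ->
  stationary F f G g lambda w xi ->
  LLICQ g w -> BLICQ G g w ->
  I00 (g w) nuhat \subset Ipos (g w) nu ->
  SOC F G g lambda w xi ->
  [/\ calH F f G g lambda w xi = 0,
      complementary (calG G g w xi) xi &
      forall a b : 'rV[R]_(s + (t + t)),
        admissible G g w xi a b ->
        free [seq col j (newton_mx F f G g lambda w xi a b)
             | j : 'I_((n + m) + (s + (t + t)))]].
Proof.
move=> w xi F2 f2 G2 g2 _ [st1 [st2 [cG [cnu cnuhat]]]] LL BL I00sub soc.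
have muE : xi_mu xi = mu by rewrite /xi_mu row_mxKl.
have nuE : xi_nu xi = nu by rewrite /xi_nu row_mxKr row_mxKl.
have nuhatE : xi_nuhat xi = nuhat by rewrite /xi_nuhat !row_mxKr.
have [df dG dg] :
    [/\ differentiable f w, differentiable G w & differentiable g w].
  by split; [case: f2 | case: G2 | case: g2].
have compl : complementary (calG G g w xi) xi.
  rewrite muE nuE nuhatE in cG cnu cnuhat.
  exact: complementary_row_mx cG (complementary_row_mx cnu cnuhat).
split=> // [|a b adm].
  (* The two blocks of [calH] are the left-hand sides of the two stationarity equations. *)
  rewrite calHE // grad_Lop // grad_lop // st1 linearD /= -mulmx_rsub.
  by rewrite -grad_yE // -jac_yE // st2 row_mx0.
apply: free_cols => z; rewrite -[z]hsubmxK.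
move: (lsubmx z) (rsubmx z) => dw dxi.
move=> /(newton_mx_kernel F2 f2 G2 g2) [H1 H2 H3].
have key i := admissible_kernel compl adm (H3 i).
(* Splits [dxi] into its three blocks, so that [key] can be read separately for [G] and for each
   copy of [g]. *)
rewrite -(hsubmxK dxi) -(hsubmxK (rsubmx dxi)) in key H1 H2 *.
move: (lsubmx dxi) (lsubmx (rsubmx dxi)) (rsubmx (rsubmx dxi)) key H1 H2.
move=> dmu dnu dnuhat key.
rewrite /xi_mu /xi_nu /xi_nuhat !row_mxKr !row_mxKl => H1 H2.
have keyG i : [/\ G w 0 i != 0 -> dmu 0 i = 0,
    G w 0 i = 0 -> 0 < mu 0 i -> 'd G w dw 0 i = 0 &
    0 <= 'd G w dw 0 i * dmu 0 i].
  by have := key (lshift _ i); rewrite !row_mxEl.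
have keynu i : [/\ g w 0 i != 0 -> dnu 0 i = 0 &
    g w 0 i = 0 -> 0 < nu 0 i -> 'd g w dw 0 i = 0].
  by have := key (rshift _ (lshift _ i)); rewrite !row_mxEr !row_mxEl => -[].
have keynuhat i : [/\ g w 0 i != 0 -> dnuhat 0 i = 0 &
    g w 0 i = 0 -> 0 < nuhat 0 i -> 'd g w dw 0 i = 0].
  by have := key (rshift _ (rshift _ i)); rewrite !row_mxEr => -[].
(* If [nuhat] vanishes at an active [i], the inclusion of index sets makes [nu] positive there;
   otherwise [nuhat] itself is positive. *)
have dgdw0 i : g w 0 i = 0 -> 'd g w dw 0 i = 0.
  move=> gi; have [nuh0|nuhN0] := eqVneq (nuhat 0 i) 0.
    have : i \in Ipos (g w) nu.
      by apply: (fintype.subsetP I00sub); rewrite !inE gi nuh0 !eqxx.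
    by rewrite !inE => /andP [_]; case: (keynu i) => _; apply.
  case: (keynuhat i) => _; apply=> //; rewrite lt0r nuhN0.
  by case: cnuhat => + _ _; rewrite nuhatE; apply.
have crit : critical G g w xi dw.
  split=> i; rewrite ?muE ?nuE ?nuhatE.
    rewrite !inE => /andP [/eqP Gi mui]; apply: row_jac_mul_tr => //.
    by case: (keyG i) => _ /(_ Gi mui).
  move=> iI; apply: row_jac_mul_tr => //; apply: dgdw0; apply/eqP.
  by move: iI; rewrite !inE -andb_orr => /andP [].
have dgrad := differentiable_grad w (C2_Lop lambda F2 G2 g2 xi).
have dw0 : dw = 0.
  apply: contrapT => /(soc _ crit); apply/negP; rewrite -leNgt.
  rewrite -mulmxA /hess (mul_jac_tr _ (differentiableP dgrad)).
  (* [P] is the Hessian of [Lop] applied to [dw]. Pairing [H1] with [dw] writes 0 as the quadratic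
     form plus a nonnegative [G]-sum plus a vanishing [g]-sum, so the form is at most 0. *)
  set P := 'd _ _ _ in H1 *; set nu' := dnu - _ in H1.
  have : (dw *m (P + dmu *m jac G w + nu' *m jac g w)^T) 0 0 =
      (dw *m P^T) 0 0 + (dw *m (dmu *m jac G w)^T) 0 0
      + (dw *m (nu' *m jac g w)^T) 0 0.
    by rewrite !linearD /= mxE [X in X + _]mxE.
  rewrite H1 trmx0 mulmx0 mxE !mul_tr_jac // [X in _ + X]big1 => [|i _].
    have : 0 <= \sum_i 'd G w dw 0 i * dmu 0 i.
      by apply: sumr_ge0 => i _; case: (keyG i).
    lra.
  (* Each term of the [g]-sum vanishes: at active indices through the derivative, at inactive ones
     because [dnu] and [dnuhat] are both zero. *)
  have [gi|gi] := eqVneq (g w 0 i) 0; first by rewrite dgdw0 ?mul0r.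
  rewrite !mxE; case: (keynu i) => -> // _; case: (keynuhat i) => -> // _.
  by rewrite mulr0 subrr mulr0.
have inact k (h : 'rV[R]_k) i : i \notin I0 h -> h 0 i != 0 by rewrite inE.
rewrite dw0 [X in X + _ + _]linear0 add0r in H1.
rewrite dw0 [X in rsubmx (X + _)]linear0 add0r in H2.
have dnuhat0 : dnuhat = 0.
  apply: (free_rows_eq0 (LLICQ_rows g2 LL)) => [i /inact gi|].
    by case: (keynuhat i) => ->.
  by rewrite mulmx_rsub.
have [dmu0 dnu0] : dmu = 0 /\ dnu = 0.
  apply: (free_rows_eq0_2 (BLICQ_rows G2 g2 BL)) => [i /inact Gi|i /inact gi|].
  - by case: (keyG i) => ->.
  - by case: (keynu i) => ->.
  (* Once [dnuhat] is zero, the coefficient of [jac g w] in [H1] is [dnu] alone. *)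
  - by rewrite -[RHS]H1 dnuhat0 scaler0 subr0.
by rewrite dw0 dmu0 dnu0 dnuhat0 !row_mx0.
Qed.
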